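(* Let $n\in\mathbb N$ and let $\Xi_n,\Lambda_n$ be the polynomials defined in the context. Then $$\Xi_n(1)=\frac{(-1)^{n-1}}{2^{2n}(2n-1)!},\qquad \Lambda_n(1)=\frac{(-1)^{n+1}\,2^{2n-1}}{(2^{2n+1}-1)(2n)!}.$$
   Context: $\mathbb N=\{1,2,3,\dots\}$. Binomial coefficients satisfy $\binom{m}{\ell}=0$ whenever $\ell<0$ or $\ell>m$. The Eulerian number of type $A$, $\left\langle{m\atop k}\right\rangle$ ($m\ge1$, $0\le k\le m-1$), is the number of permutations of $\{1,\dots,m\}$ with exactly $k$ descents; equivalently $\sum_{j\ge0}(j+1)^m x^j=(1-x)^{-m-1}\sum_{k=0}^{m-1}\left\langle{m\atop k}\right\rangle x^k$ for $|x|<1$. The Eulerian number of type $B$, $\left\langle{m\atop k}\right\rangle^{B}$ ($m\ge0$, $0\le k\le m$), is determined by $\sum_{j\ge0}(2j+1)^m x^j=(1-x)^{-m-1}\sum_{k=0}^{m}\left\langle{m\atop k}\right\rangle^{B} x^k$ for $|x|<1$. For $n\in\mathbb N$ and $0\le t\le n-1$ let $$\mathcal C^{(B)}_{n,t}:=\sum_{k=0}^{n-1}\left\langle {2n-1 \atop k}\right\rangle^{B}(-1)^{k}\sum_{i=0}^{k}(-1)^i\binom{k}{i}\binom{2n-2k-1}{2t-2i+1},\quad \mathcal C^{(A)}_{n,t}:=\sum_{k=0}^{n-1}\left\langle {2n \atop k}\right\rangle(-1)^{k}\sum_{i=0}^{k}(-1)^i\binom{k}{i}\binom{2n-2k-1}{2t-2i+1},$$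 $$\Xi_n(x):=\frac{(-1)^{n+1}}{2^{4n-2}(2n-1)!}\sum_{t=0}^{n-1}\mathcal C^{(B)}_{n,t}\,x^{2t},\qquad \Lambda_n(x):=\frac{2(-1)^{n+1}}{(2^{2n+1}-1)(2n)!}\sum_{t=0}^{n-1}\mathcal C^{(A)}_{n,t}\,x^{2t}.$$ *)

(* Defs.v *)
From mathcomp Require Import all_boot all_order all_fingroup all_algebra.
From mathcomp Require Import all_classical all_reals all_analysis.
Set Implicit Arguments.
Unset Strict Implicit.
Unset Printing Implicit Defensive.
Import Order.TTheory GRing.Theory Num.Theory.
Import numFieldNormedType.Exports.
Local Open Scope ring_scope.

(* The lower index ranges over the integers: with the truncated subtraction of
   nat, [2 * t - 2 * i + 1] would be 1 instead of negative when [t < i]. *)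
Definition binz (m : nat) (l : int) : nat :=
  match l with
  | Posz k => 'C(m, k)
  | Negz _ => 0%N
  end.

(* Permutations of {1, ..., m} are taken on {0, ..., m - 1}. *)
Definition descents (m : nat) (s : 'S_m) : {set 'I_m} :=
  [set i : 'I_m | [exists j : 'I_m, (j == i.+1 :> nat) && (s j < s i)%N]]%SET.

Definition eulerianA (m k : nat) : nat :=
  #|[set s : 'S_m | #|descents s| == k]%SET|.

Definition is_eulerianB_poly (R : realType) (m : nat) (p : {poly R}) : Prop :=
  (size p <= m.+1)%N /\
  forall x : R, `|x| < 1 ->
    (series (fun j : nat => (2 * j + 1)%:R ^+ m * x ^+ j) @ \oo -->
      (1 - x) ^- m.+1 * p.[x])%classic.

(* [xget] selects the unique polynomial characterized by the generating
   function; its coefficients are the Eulerian numbers of type B. *)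
Definition eulerianB_poly (R : realType) (m : nat) : {poly R} :=
  xget 0 [set p : {poly R} | is_eulerianB_poly m p]%classic.

Definition eulerianB (R : realType) (m k : nat) : R := (eulerianB_poly R m)`_k.

Definition Csum (R : realType) (e : nat -> R) (n t : nat) : R :=
  \sum_(0 <= k < n) e k * (-1) ^+ k *
    \sum_(0 <= i < k.+1) (-1) ^+ i * 'C(k, i)%:R *
      (binz (2 * n - 2 * k - 1) ((2 * t)%:Z - (2 * i)%:Z + 1))%:R.

Definition CB (R : realType) (n t : nat) : R :=
  Csum (eulerianB R (2 * n - 1)) n t.

Definition CA (R : realType) (n t : nat) : R :=
  Csum (fun k => (eulerianA (2 * n) k)%:R) n t.

Definition Xi (R : realType) (n : nat) : {poly R} :=
  ((-1) ^+ n.+1 / (2 ^+ (4 * n - 2) * (2 * n - 1)`!%:R)) *: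
    \sum_(0 <= t < n) CB R n t *: 'X^(2 * t).

Definition Lambda (R : realType) (n : nat) : {poly R} :=
  (2 * (-1) ^+ n.+1 / ((2 ^+ (2 * n + 1) - 1) * (2 * n)`!%:R)) *:
    \sum_(0 <= t < n) CA R n t *: 'X^(2 * t).

(* Main.v *)
Require Import Defs.
From mathcomp Require Import all_boot all_order all_fingroup all_algebra.
From mathcomp Require Import all_classical all_reals all_analysis.
From mathcomp Require Import zify ring lra.
Import Order.TTheory GRing.Theory Num.Theory.
Import numFieldNormedType.Exports.
Local Open Scope ring_scope.

(** Evaluating at 1 sums the coefficients over [t], and this sum collapses.
    For fixed [k] and [i] the lower indices [2t - 2i + 1] run through all odd
    numbers that contribute to row [2n - 2k - 1] of Pascal's triangle, so the
    sum over [t] is [2 ^ (2n - 2k - 2)] whatever [i] is ([sum_binz]).  The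
    remaining alternating sum of ['C(k, i)] over [i] is [(1 - 1) ^ k], which
    kills every [k] except [k = 0].  Hence the coefficients add up to
    [2 ^ (2n - 2)] times the Eulerian number of index 0 ([sum_Csum]).

    Both Eulerian numbers of index 0 are 1.  In type A the identity is the only
    permutation without descents ([eulerianA0]).  In type B the number is the
    constant coefficient of the numerator of a generating function, so it is the
    value of the series at [x = 0], that is, its first term ([eulerianB0]).

    This last argument presupposes that the numerator exists.  More generally,
    if [q] is a polynomial of degree less than [d], then the series of
    [q(j) x^j] is a polynomial of degree less than [d] over [(1 - x) ^ d]
    ([generating_function_poly]).  The proof is by induction on [d]:
    multiplication by [1 - x] turns [q] into its forward difference
    [q(X + 1) - q], whose degree is smaller, up to a boundary term
    [q(N) x^N] that tends to 0. *)

(** * Sums of binomial coefficients *)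

(** By Pascal's rule, an odd-index entry of an odd row is the sum of two
    consecutive entries of the row above, and these pairs exhaust that row. *)
Lemma sum_odd_bin (N : nat) :
  (\sum_(s < N.+1) 'C((2 * N).+1, 2 * s + 1) = 2 ^ (2 * N))%N.
Proof.
have two_terms (M : nat) (F : nat -> nat) :
    (\sum_(s < M) (F (2 * s) + F (2 * s).+1) = \sum_(j < 2 * M) F j)%N.
  elim: M => [|M IH]; first by rewrite !big_ord0.
  by rewrite big_ord_recr IH mulnS !big_ord_recr /= addnA.
under eq_bigr do rewrite addn1 binS.
under eq_bigr do rewrite addnC.
(* The pairs overshoot row [2 * N] by a single entry, which vanishes. *)
rewrite (two_terms _ (binomial (2 * N))) mulnS add2n big_ord_recr /=.
rewrite bin_small // addn0 -[2%N]/(1 + 1)%N expnDn.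
by apply: eq_bigr => i _; rewrite !exp1n !muln1.
Qed.

Lemma sum_sign_bin (R : comPzRingType) (k : nat) :
  \sum_(0 <= i < k.+1) (-1) ^+ i * 'C(k, i)%:R = (k == 0%N)%:R :> R.
Proof.
rewrite big_mkord -expr0n -[0 in RHS](subrr 1) exprDn.
by apply: eq_bigr => i _; rewrite expr1n mul1r mulr_natr.
Qed.

(** * Generating functions of polynomial sequences *)

(** The leading terms of [q(X + 1)] and [q] agree.  The induction peels off the
    constant term: the difference for [q * X + c] is the difference for [q]
    times [X], plus [q(X + 1)]. *)
Lemma size_diff_poly (R : comNzRingType) (q : {poly R}) (d : nat) :
  (size q <= d.+1)%N -> (size (q \Po ('X + 1) - q)%R <= d)%N.
Proof.
elim/poly_ind: q d => [|q c IH] d; first by rewrite comp_poly0 subrr size_poly0.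
have [-> _|q0] := eqVneq q 0.
  by rewrite mul0r add0r comp_polyC subrr size_poly0.
rewrite size_MXaddC (negPf q0) /= ltnS => qd.
rewrite comp_polyD comp_polyM comp_polyX comp_polyC.
have -> : (q \Po ('X + 1)) * ('X + 1) + c%:P - (q * 'X + c%:P) =
  (q \Po ('X + 1) - q) * 'X + (q \Po ('X + 1)) by ring.
apply: (leq_trans (size_polyD _ _)); rewrite geq_max; apply/andP; split.
  case: d qd => [|d] qd; first by rewrite leqn0 size_poly_eq0 (negPf q0) in qd.
  by apply: (leq_trans (size_mul_leq _ _)); rewrite size_polyX addn2 ltnS IH.
rewrite (leq_trans _ qd) // (leq_trans (size_comp_poly_leq _ _)) //.
by rewrite -[1]/1%:P size_XaddC /= muln1 prednK // size_poly_gt0.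
Qed.

(** A geometric sequence beats any polynomial.  Each further power of [n] is
    absorbed by replacing [x] with [x / s] for some [s] between [|x|] and 1,
    because [n * s ^ n] is bounded. *)
Lemma cvg_horner_expr (R : realType) (q : {poly R}) (x : R) :
  `|x| < 1 -> ((fun n => (q.[n%:R] : R) * x ^+ n) @ \oo --> (0 : R))%classic.
Proof.
elim/poly_ind: q x => [|q c IH] x x1.
  by under eq_fun do rewrite horner0 mul0r; exact: cvg_cst.
pose s : R := (1 + `|x|) / 2.
have s0 : 0 < s by rewrite /s; have := normr_ge0 x; lra.
have s1 : s < 1 by rewrite /s; lra.
have xs : `|x / s| < 1.
  by rewrite normrM normfV (gtr0_norm s0) ltr_pdivrMr // mul1r /s; lra.
(* Each of the [n] terms of [(1 - s) * (1 + s + ... + s ^ (n - 1))], which sums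
   to [1 - s ^ n], is at least [(1 - s) * s ^ n]. *)
have bound n : n%:R * (1 - s) * s ^+ n + s ^+ n <= 1.
  elim: n => [|n IHn]; first by rewrite !mul0r add0r.
  have sn : s ^+ n <= 1 by rewrite exprn_ile1 // ltW.
  have h1 : 0 <= s * (1 - (n%:R * (1 - s) * s ^+ n + s ^+ n)).
    by rewrite mulr_ge0 ?subr_ge0 // ltW.
  have h2 : 0 <= s * (1 - s) * (1 - s ^+ n).
    by rewrite !mulr_ge0 ?subr_ge0 // ltW.
  have h3 := sqr_ge0 (1 - s).
  by rewrite exprS -natr1; nra.
have split_term n : (q * 'X + c%:P).[n%:R] * x ^+ n =
    (n%:R * s ^+ n) * (q.[n%:R] * (x / s) ^+ n) + c * x ^+ n.
  rewrite hornerMXaddC [(x / s) ^+ n]exprMn exprVn mulrDl; congr (_ + _).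
  have := expf_neq0 n (lt0r_neq0 s0); set sn := s ^+ n => sn0.
  by field.
pose u n : R := n%:R * s ^+ n * (q.[n%:R] * (x / s) ^+ n).
pose v n : R := c * x ^+ n.
rewrite (_ : (fun n => _) = u \+ v); last exact/funext.
have v0 : (v @ \oo --> (0 : R))%classic.
  by rewrite -(mulr0 c); apply: cvgMl_tmp; exact: cvg_expr.
suff u0 : (u @ \oo --> (0 : R))%classic.
  by rewrite -(addr0 (0 : R)); exact: cvgD.
apply: norm_cvg0; have /cvg_norm := IH _ xs; rewrite normr0 => IHx.
apply: (@squeeze_cvgr _ _ _ _ (fun=> 0)
  (fun n => (1 - s)^-1 * `|q.[n%:R] * (x / s) ^+ n|)).
- near=> n; rewrite normr_ge0 /= normrM ler_wpM2r //.
  have n0 : 0 <= n%:R * s ^+ n by rewrite mulr_ge0 // exprn_ge0 // ltW.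
  rewrite ger0_norm // -[leRHS]mul1r ler_pdivlMr ?subr_gt0 //.
  have := bound n; have := exprn_ge0 n (ltW s0); nra.
- exact: cvg_cst.
- by rewrite -(mulr0 (1 - s)^-1); apply: cvgMl_tmp.
Unshelve. all: by end_near.
Qed.

(** Abel summation: multiplying a partial sum by [1 - x] replaces the
    coefficients by their forward differences. *)
Lemma abel_summation (R : comNzRingType) (q : {poly R}) (x : R) (N : nat) :
  (1 - x) * (\sum_(0 <= j < N.+1) q.[j%:R] * x ^+ j) =
  q.[0] + x * (\sum_(0 <= j < N) (q \Po ('X + 1) - q).[j%:R] * x ^+ j)
  - x * (q.[N%:R] * x ^+ N).
Proof.
elim: N => [|N IH]; first by rewrite !big_nat1 big_geq // expr0; ring.
rewrite big_nat_recr //= mulrDr IH [in RHS]big_nat_recr //=.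
have -> : (q \Po ('X + 1) - q).[N%:R] = q.[N.+1%:R] - q.[N%:R].
  by rewrite hornerD hornerN horner_comp !hornerE natr1.
rewrite exprS; ring.
Qed.

(** Letting [N] tend to infinity in [abel_summation] gives the recursion
    [p = q(0) (1 - X)^d + X p'] between the numerators [p] for [q] and [p'] for
    the forward difference of [q]. *)
Lemma generating_function_poly (R : realType) (d : nat) (q : {poly R}) :
  (size q <= d)%N -> exists p : {poly R}, (size p <= d)%N /\
  forall x : R, `|x| < 1 ->
    (series (fun j : nat => q.[j%:R] * x ^+ j) @ \oo -->
      (1 - x) ^- d * p.[x])%classic.
Proof.
elim: d q => [|d IH] q qd.
  move: qd; rewrite leqn0 size_poly_eq0 => /eqP ->.
  exists 0; rewrite size_poly0; split=> // x _.
  rewrite horner0 mulr0 (_ : series _ = fun=> 0); first exact: cvg_cst.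
  by apply/funext => N; rewrite /series /= big1 // => j _; rewrite horner0 mul0r.
have [p [pd cvg_p]] := IH _ (size_diff_poly _ _ _ qd).
exists (q.[0] *: (1 - 'X) ^+ d + p * 'X); split.
  apply: (leq_trans (size_polyD _ _)); rewrite geq_max; apply/andP; split.
    apply: (leq_trans (size_scale_leq _ _)).
    rewrite (leq_trans (size_poly_exp_leq _ _)) // -opprB size_polyN.
    by rewrite -[1]/1%:P size_XsubC mul1n.
  by apply: (leq_trans (size_mul_leq _ _)); rewrite size_polyX addn2.
move=> x x1.
have x1' : 1 - x != 0.
  by rewrite subr_eq0; apply: contraTneq x1 => <-; rewrite normr1 ltxx.
pose T : R^nat := series (fun j : nat => (q \Po ('X + 1) - q).[j%:R] * x ^+ j).
pose a N : R := q.[N%:R] * x ^+ N.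
rewrite -cvg_shiftS.
rewrite (_ : (fun n => _) = fun N => (1 - x)^-1 * (q.[0] + x * T N - x * a N));
  last first.
  by apply/funext => N; rewrite -abel_summation mulKf.
have -> : (1 - x) ^- d.+1 * (q.[0] *: (1 - 'X) ^+ d + p * 'X).[x] =
   (1 - x)^-1 * (q.[0] + x * ((1 - x) ^- d * p.[x]) - x * 0).
  rewrite -polyC1 exprS.
  rewrite !(hornerD, hornerZ, hornerM, horner_exp, hornerN, hornerX, hornerC).
  have := expf_neq0 d x1'; set y := (1 - x) ^+ d => y0.
  by field; rewrite y0 x1'.
apply: cvgMl_tmp; apply: cvgB; last first.
  by apply: cvgMl_tmp; exact: cvg_horner_expr.
apply: cvgD; first exact: cvg_cst.
by apply: cvgMl_tmp; exact: cvg_p.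
Qed.

(** * Eulerian numbers of index 0 *)

(** The word of a permutation without descents is strictly increasing and has
    the letters [0], ..., [m - 1], so it is the sorted enumeration of them. *)
Lemma descents0 (m : nat) (s : 'S_m) : #|descents s| = 0%N -> s = 1%g.
Proof.
move=> /eqP; rewrite cards_eq0 => /eqP s0.
pose word := [seq (s i : nat) | i <- enum 'I_m].
have size_word : size word = m by rewrite size_map size_enum_ord.
have nth_word i (im : (i < m)%N) : nth 0%N word i = s (Ordinal im).
  rewrite (nth_map (Ordinal im)) ?size_enum_ord //; congr (nat_of_ord (s _)).
  by apply: val_inj; rewrite /= nth_enum_ord.
have word_iota : word = iota 0 m.
  apply: (irr_sorted_eq ltn_trans ltnn); last first.
  - move=> j; rewrite mem_iota /= add0n; apply/mapP/idP => [[i _ ->]|jm].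
      exact: ltn_ord.
    by exists (s^-1 (Ordinal jm))%g; rewrite ?mem_enum // permKV.
  - exact: iota_ltn_sorted.
  apply/(sortedP 0%N) => i; rewrite size_word => im.
  have im' := ltnW im; rewrite (nth_word _ im) (nth_word _ im').
  have /finset.setP/(_ (Ordinal im')) := s0; rewrite !inE => /negbT.
  rewrite negb_exists => /forallP/(_ (Ordinal im)); rewrite eqxx /= -leqNgt.
  rewrite leq_eqVlt => /orP[/eqP/val_inj/perm_inj/(congr1 val)/= /n_Sn // | //].
apply/permP => i; apply: val_inj; rewrite perm1 /=.
rewrite -[i in LHS](_ : Ordinal (ltn_ord i) = i); last exact: val_inj.
by rewrite -nth_word word_iota nth_iota.
Qed.

Lemma eulerianA0 (m : nat) : eulerianA m 0 = 1%N.
Proof.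
rewrite /eulerianA -[RHS](cards1 (1%g : 'S_m)); apply: eq_card => s.
rewrite !inE; apply/eqP/eqP => [/descents0 // | ->].
apply/eqP; rewrite cards_eq0 -finset.subset0; apply/fintype.subsetP => i.
by rewrite !inE => /existsP[j /andP[/eqP ji]]; rewrite !perm1 ji ltnNge leqnSn.
Qed.

(** The powers [(2j + 1)^m] are values of a polynomial of degree at most [m],
    so the characterization that selects the numerator is satisfiable. *)
Lemma eulerianB_polyP (R : realType) (m : nat) :
  is_eulerianB_poly m (eulerianB_poly R m).
Proof.
apply: xgetPex.
have size_base : (size (2 *: 'X + 1 : {poly R})%R <= 2)%N.
  rewrite (leq_trans (size_polyD _ _)) // geq_max size_poly1 andbT.
  by rewrite (leq_trans (size_scale_leq _ _)) ?size_polyX.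
have [|p [pm cvg_p]] := generating_function_poly R m.+1 ((2 *: 'X + 1) ^+ m).
  rewrite (leq_trans (size_poly_exp_leq _ _)) // ltnS -[leqRHS]mul1n.
  by rewrite leq_mul2r; apply/orP; right; case: size size_base.
exists p; split=> // x /cvg_p; apply: cvg_trans.
rewrite (_ : series (fun j : nat => _) =
  series (fun j : nat => (2 * j + 1)%:R ^+ m * x ^+ j)) //.
apply/funext => N; apply: eq_bigr => j _.
by rewrite !hornerE natrD natrM.
Qed.

Lemma eulerianB0 (R : realType) (m : nat) : eulerianB R m 0 = 1.
Proof.
have [_ /(_ 0)] := eulerianB_polyP R m; rewrite normr0 ltr01 => /(_ isT).
rewrite subr0 expr1n invr1 mul1r horner_coef0 => gen0.
apply: (cvg_unique (@norm_hausdorff _ R) gen0); apply: cvg_near_cst; near=> N.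
have N0 : (0 < N)%N by near: N; exact: nbhs_infty_gt.
rewrite /series /= -(prednK N0) big_nat_recl //= muln0 expr1n expr0 mulr1.
by rewrite big1 ?addr0 // => j _; rewrite expr0n mulr0.
Unshelve. all: by end_near.
Qed.

(** * Sums of the coefficients *)

(** The nonzero terms are those with [i <= t < i + (n - k)]; since [i <= k], all
    of them lie in the range of summation. *)
Lemma sum_binz (n k i : nat) : (k < n)%N -> (i <= k)%N ->
  (\sum_(0 <= t < n) binz (2 * n - 2 * k - 1) ((2 * t)%:Z - (2 * i)%:Z + 1)
   = 2 ^ (2 * (n - k.+1)))%N.
Proof.
move=> kn ik; rewrite -sum_odd_bin.
have in_ : (i + (n - k) <= n)%N by lia.
rewrite (big_cat_nat _ (n := i)) //=; last by lia.
rewrite [X in (X + _)%N]big1_seq ?add0n; last first.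
  move=> t /andP[_]; rewrite mem_index_iota => /andP[_ ti].
  have -> // : (2 * t)%:Z - (2 * i)%:Z + 1 = Negz (2 * (i - t.+1)).
  by rewrite NegzE; lia.
rewrite (big_cat_nat _ (n := (i + (n - k))%N)) /=; [|lia..].
rewrite [X in (_ + X)%N]big1_seq ?addn0; last first.
  move=> t /andP[_]; rewrite mem_index_iota => /andP[it _].
  have -> : (2 * t)%:Z - (2 * i)%:Z + 1 = (2 * (t - i) + 1)%N%:Z by lia.
  by rewrite /= bin_small //; lia.
rewrite -{1}[i]add0n big_addn addKn subnSK // big_mkord.
apply: eq_bigr => t _.
have -> : (2 * (t + i))%:Z - (2 * i)%:Z + 1 = (2 * t + 1)%N%:Z by lia.
by rewrite /=; congr 'C(_, _); lia.
Qed.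

(** Exchanging the sums makes the inner factor independent of [i], which leaves
    the alternating sum of ['C(k, i)], zero unless [k = 0]. *)
Lemma sum_Csum (R : realType) (e : nat -> R) (n : nat) : (0 < n)%N ->
  \sum_(0 <= t < n) Csum e n t = e 0%N * 2 ^+ (2 * (n - 1)).
Proof.
move=> n0; rewrite exchange_big /=.
under eq_bigr do rewrite -mulr_sumr exchange_big /=.
have inner k : (k < n)%N -> \sum_(0 <= i < k.+1) \sum_(0 <= t < n)
    (-1) ^+ i * 'C(k, i)%:R *
      (binz (2 * n - 2 * k - 1) ((2 * t)%:Z - (2 * i)%:Z + 1))%:R =
    (k == 0%N)%:R * 2 ^+ (2 * (n - k.+1)) :> R.
  move=> kn; rewrite -sum_sign_bin mulr_suml; apply: eq_big_nat => i /andP[_ ik].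
  by rewrite -mulr_sumr -natr_sum sum_binz // natrX.
rewrite (eq_big_nat _ _ (F2 := fun k => e k * (-1) ^+ k *
  ((k == 0%N)%:R * 2 ^+ (2 * (n - k.+1))))); last first.
  by move=> k /andP[_ kn]; rewrite inner.
rewrite -(prednK n0) big_nat_recl //= mul1r expr0 mulr1 big1 ?addr0 //.
by move=> k _; rewrite mul0r mulr0.
Qed.

Lemma horner1_even_poly (R : comNzRingType) (c : nat -> R) (n : nat) :
  (\sum_(0 <= t < n) c t *: 'X^(2 * t)).[1] = \sum_(0 <= t < n) c t.
Proof.
rewrite horner_sum; apply: eq_bigr => t _.
by rewrite hornerZ hornerXn expr1n mulr1.
Qed.

Theorem proposition8p3 (R : realType) (n : nat) (hn : (0 < n)%N) :
  (Xi R n).[1] = (-1) ^+ (n - 1) / (2 ^+ (2 * n) * (2 * n - 1)`!%:R) /\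
  (Lambda R n).[1] =
    (-1) ^+ n.+1 * 2 ^+ (2 * n - 1) / ((2 ^+ (2 * n + 1) - 1) * (2 * n)`!%:R).
Proof.
rewrite /Xi /Lambda !hornerZ !horner1_even_poly !sum_Csum //.
rewrite eulerianB0 eulerianA0.
case: n hn => // n _; rewrite subSS subn0 !mul1r.
split.
  rewrite (_ : 4 * n.+1 - 2 = 2 * n + 2 * n.+1)%N; last by lia.
  rewrite exprD !exprS !mulN1r opprK.
  have f0 : (2 * n.+1 - 1)`!%:R != 0 :> R by rewrite pnatr_eq0 -lt0n fact_gt0.
  have p0 k : 2 ^+ k != 0 :> R by rewrite expf_neq0 // pnatr_eq0.
  by field; rewrite f0 !p0.
rewrite (_ : 2 * n.+1 - 1 = (2 * n).+1)%N; last by lia.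
by rewrite [2 ^+ (2 * n).+1]exprS; ring.
Qed.
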